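(* Every 2-local 1-automorphism of a finite dimensional formally real exceptional simple Jordan algebra $\mathcal{A}$ is an automorphism.
   Context: A real Jordan algebra is formally real if $\sum_i a_i^2=0$ (finite sum) implies each $a_i=0$; $\mathcal{A}$ is unital with identity $1$. Exceptional means not isomorphic to a Jordan subalgebra of $R^+$ (product $\frac12(ab+ba)$) for an associative algebra $R$. A symmetry is $s$ with $s^2=1$, $U_s(x)=2s(sx)-x$. A 2-local 1-automorphism is a map $\Delta$ (not assumed linear) such that for every $x,y$ there is a symmetry $s$ with $\Delta(x)=U_s(x)$, $\Delta(y)=U_s(y)$. *)

(* Defs.v *)
From mathcomp Require Import all_boot all_order all_algebra.
From mathcomp Require Import reals.
Set Implicit Arguments. Unset Strict Implicit. Unset Printing Implicit Defensive.
Import Order.TTheory GRing.Theory Num.Theory.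
Local Open Scope ring_scope.

Section Jordan.
Variable R : realType.

Definition is_unital_jordan_algebra (A : lmodType R) (mul : A -> A -> A) (one : A) :=
  [/\ forall x y z, mul (x + y) z = mul x z + mul y z,
      forall (a : R) x y, mul (a *: x) y = a *: mul x y,
      forall x y, mul x y = mul y x,
      forall x y, mul (mul (mul x x) y) x = mul (mul x x) (mul y x)
    & forall x, mul one x = x].

Definition formally_real (A : lmodType R) (mul : A -> A -> A) :=
  forall s : seq A, \sum_(a <- s) mul a a = 0 -> forall a, a \in s -> a = 0.

Definition jordan_ideal (A : vectType R) (mul : A -> A -> A) (I : {vspace A}) :=
  forall x y, x \in I -> mul y x \in I.

Definition jordan_simple (A : vectType R) (mul : A -> A -> A) :=
  (exists x : A, x != 0) /\
  forall I : {vspace A}, jordan_ideal mul I -> I = 0%VS \/ I = fullv.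

(* special: isomorphic to a Jordan subalgebra of B^+ for some associative real
   algebra B, i.e. there is an injective linear map into B which is a
   homomorphism for x o y = 1/2 (xy + yx). *)
Definition jordan_special (A : lmodType R) (mul : A -> A -> A) :=
  exists (B : algType R) (phi : A -> B),
    [/\ forall x y, phi (x + y) = phi x + phi y,
        forall (a : R) x, phi (a *: x) = a *: phi x,
        injective phi
      & forall x y, phi (mul x y) = 2^-1 *: (phi x * phi y + phi y * phi x)].

Definition jordan_exceptional (A : lmodType R) (mul : A -> A -> A) :=
  ~ jordan_special mul.

Definition symmetry (A : lmodType R) (mul : A -> A -> A) (one s : A) :=
  mul s s = one.

Definition Uop (A : lmodType R) (mul : A -> A -> A) (s x : A) :=
  mul s (mul s x) *+ 2 - x.

Definition two_local_1_automorphism (A : lmodType R) (mul : A -> A -> A) (one : A)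
    (D : A -> A) :=
  forall x y, exists s, [/\ symmetry mul one s, D x = Uop mul s x & D y = Uop mul s y].

Definition jordan_automorphism (A : lmodType R) (mul : A -> A -> A) (D : A -> A) :=
  [/\ forall x y, D (x + y) = D x + D y,
      forall (a : R) x, D (a *: x) = a *: D x,
      bijective D
    & forall x y, D (mul x y) = mul (D x) (D y)].

End Jordan.

(* Main.v *)
(* The trace form t(x, y) = tr L_(xy) is associative, since L_(z(wx)) - L_(w(zx))
   is a sum of two commutators by the linearized Jordan identity; its radical is
   therefore an ideal, and it is proper because tr L_1 = dim A, so simplicity makes
   t nondegenerate.  For a symmetry s, the Peirce decomposition shows that U_s is
   an involutive automorphism, hence a t-isometry; so D preserves t on every pair.
   A map preserving a nondegenerate form in finite dimension sends a basis to a
   basis and is therefore linear and bijective.  Applied to the pair (x, x^2),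
   2-locality gives D(x^2) = D(x)^2, and linearity allows polarization. *)
Require Import Defs.
From HB Require Import structures.
From mathcomp Require Import all_boot all_order all_algebra.
From mathcomp Require Import reals.
From mathcomp Require Import lra.
Set Implicit Arguments. Unset Strict Implicit. Unset Printing Implicit Defensive.
Import Order.TTheory GRing.Theory Num.Theory VectorInternalTheory.
Local Open Scope ring_scope.

(** * Trace of an endomorphism in coordinates *)

Section Trace.
Context {K : fieldType} {V : vectType K}.
Implicit Types f g : {linear V -> V}.

(** Takes bare functions, so that [mul x] and lambda terms can be traced directly; it is the usual
    trace when [f] is linear. *)
Definition fun_trace (f : V -> V) : K := \tr (lin1_mx (v2r \o f \o r2v)).

Lemma eq_fun_trace (f g : V -> V) : f =1 g -> fun_trace f = fun_trace g.
Proof.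
move=> fg; rewrite /fun_trace; congr (\tr _).
by apply/matrixP => i j; rewrite !mxE /= fg.
Qed.

Lemma fun_traceC f g : fun_trace (f \o g) = fun_trace (g \o f).
Proof.
have mxM (h k : {linear V -> V}) : lin1_mx (v2r \o (h \o k) \o r2v) =
    lin1_mx (v2r \o k \o r2v) *m lin1_mx (v2r \o h \o r2v) :> 'M[K]_(dim V).
  by apply/row_matrixP => i; rewrite row_mul !rowE !mul_rV_lin1 /= v2rK.
by rewrite /fun_trace !mxM mxtrace_mulC.
Qed.

Lemma fun_traceP a (f g : V -> V) :
  fun_trace (fun x => a *: f x + g x) = a * fun_trace f + fun_trace g.
Proof.
rewrite /fun_trace -mxtraceZ -mxtraceD; congr (\tr _).
by apply/matrixP => i j; rewrite !mxE /= linearP !mxE.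
Qed.

Lemma fun_trace_id : fun_trace id = (dim V)%:R.
Proof.
rewrite /fun_trace -(mxtrace1 K); congr (\tr _).
by apply/matrixP => i j; rewrite !mxE /= r2vK mxE eqxx eq_sym.
Qed.

End Trace.

(* Reduces linear identities in V to identities in K, where lra applies. *)
Lemma eq_coord {K : fieldType} {V : vectType K} (x y : V) :
  (forall f : {linear V -> K^o}, f x = f y) -> x = y.
Proof.
move=> eqxy; apply: (can_inj v2rK); apply/rowP => i.
pose c (v : V) : K^o := v2r v ord0 i.
have lc : linear c by move=> a u v; rewrite /c linearP !mxE.
pose cL := GRing.isLinear.Build K V K^o *:%R c lc.
pose f : {linear V -> K^o} := HB.pack c cL.
exact: (eqxy f).
Qed.

(** * Maps preserving a nondegenerate symmetric bilinear form *)

Section NondegenerateForm.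
Context {K : fieldType} {V : vectType K}.
Variable t : V -> V -> K.
Hypothesis tC : forall x y, t x y = t y x.
Hypothesis tP : forall a x y z, t (a *: x + y) z = a * t x z + t y z.
Hypothesis t_nondeg : forall x, (forall y, t x y = 0) -> x = 0.
Variable D : V -> V.
Hypothesis Dt : forall x y, t (D x) (D y) = t x y.

Let t0 z : t 0 z = 0.
Proof. by have := tP (-1) 0 0 z; rewrite scaler0 addr0 mulN1r addNr. Qed.

Let tB x y z : t (x - y) z = t x z - t y z.
Proof. by rewrite addrC -scaleN1r tP mulN1r addrC. Qed.

Let t_sum (n : nat) (c : 'I_n -> K) (v : 'I_n -> V) z :
  t (\sum_i c i *: v i) z = \sum_i c i * t (v i) z.
Proof.
elim/big_rec2: _ => [|i a u _ <-]; first exact: t0.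
by rewrite tP.
Qed.

Let b := vbasis (fullv : {vspace V}).
Let Db := map_tuple D b.

Let b_basis : basis_of fullv b. Proof. exact: vbasisP. Qed.

(** A linear relation among the images of [b], paired with [D y], becomes by [Dt] the same relation
    among the vectors of [b] paired with [y]; nondegeneracy then makes it trivial. *)
Let Db_basis : basis_of fullv Db.
Proof.
rewrite basisEfree subvf size_tuple leqnn !andbT.
apply/freeP => c; under eq_bigr => i _ do rewrite (nth_map 0) ?size_tuple //.
move=> c0; have /freeP := basis_free b_basis; apply.
apply: t_nondeg => y; have := t0 (D y); rewrite -{1}c0 !t_sum => c0y.
by rewrite -[RHS]c0y; apply: eq_bigr => i _; rewrite Dt.
Qed.

(** The defect of linearity is orthogonal to each vector of the basis [Db], since [Dt] removes [D]
    from all these pairings. *)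
Lemma isometry_linear : linear D.
Proof.
move=> a x y; apply/eqP; rewrite -subr_eq0; apply/eqP.
apply: t_nondeg => z; rewrite tC (coord_basis Db_basis (memvf z)) t_sum.
rewrite big1 // => i _; rewrite (nth_map 0) ?size_tuple // tC.
by rewrite tB tP !Dt tP subrr mulr0.
Qed.

Lemma isometry_bijective : bijective D.
Proof.
pose DL : {linear V -> V} := HB.pack D (GRing.isLinear.Build K V V *:%R D isometry_linear).
have injD x y : D x = D y -> x = y.
  move=> Dxy; apply/eqP; rewrite -subr_eq0; apply/eqP; apply: t_nondeg => z.
  by rewrite tB -[t x z]Dt -[t y z]Dt Dxy subrr.
(* [g] carries [Db] back to [b]: a right inverse of [D] by linearity, a left inverse by
   injectivity. *)
pose g y := \sum_i coord Db i y *: b`_i.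
have gK : cancel g D.
  move=> y; rewrite [RHS](coord_basis Db_basis (memvf y)).
  rewrite -[D _]/(DL _) linear_sum; apply: eq_bigr => i _.
  by rewrite linearZ (nth_map 0) ?size_tuple.
by exists g => // x; apply: injD; rewrite gK.
Qed.

End NondegenerateForm.

(** * Jordan identities and the trace form *)

Section Jordan.
Context {R : realType} {A : vectType R} {mul : A -> A -> A} {one : A}.
Hypothesis hJ : is_unital_jordan_algebra mul one.
Local Notation "x ∘ y" := (mul x y) (at level 40, left associativity).
Implicit Types x y z w s : A.

Let mulC x y : x ∘ y = y ∘ x. Proof. by case: hJ. Qed.
Let mulDl x y z : (x + y) ∘ z = x ∘ z + y ∘ z. Proof. by case: hJ. Qed.
Let mulDr x y z : z ∘ (x + y) = z ∘ x + z ∘ y.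
Proof. by rewrite mulC mulDl !(mulC z). Qed.
Let mulZl a x y : (a *: x) ∘ y = a *: (x ∘ y). Proof. by case: hJ. Qed.
Let mulZr a x y : x ∘ (a *: y) = a *: (x ∘ y).
Proof. by rewrite mulC mulZl mulC. Qed.
Let mulNl x y : (- x) ∘ y = - (x ∘ y).
Proof. by rewrite -scaleN1r mulZl scaleN1r. Qed.
Let mulNr x y : x ∘ (- y) = - (x ∘ y).
Proof. by rewrite mulC mulNl mulC. Qed.
Let mul1 x : one ∘ x = x. Proof. by case: hJ. Qed.
Let mul_linear x : linear (mul x).
Proof. by move=> a u v; rewrite mulDr mulZr. Qed.

HB.instance Definition _ x := GRing.isLinear.Build R A A *:%R (mul x) (mul_linear x).

Let mul0l x : 0 ∘ x = 0. Proof. by rewrite mulC linear0. Qed.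

(** The Jordan identity is cubic in [u]; inclusion-exclusion over sums of [x], [y], [z] isolates
    twice its trilinear part. *)
Lemma jordan_linearized x y z w :
  (x ∘ y) ∘ (z ∘ w) + (y ∘ z) ∘ (x ∘ w) + (z ∘ x) ∘ (y ∘ w) =
  ((x ∘ y) ∘ w) ∘ z + ((y ∘ z) ∘ w) ∘ x + ((z ∘ x) ∘ w) ∘ y.
Proof.
have J u : ((u ∘ u) ∘ w) ∘ u = (u ∘ u) ∘ (u ∘ w).
  by rewrite (mulC u w); case: hJ.
have := J (x + y + z); have := J (x + y); have := J (y + z); have := J (z + x).
have := J x; have := J y; have := J z.
rewrite !(mulDl, mulDr) (mulC y x) (mulC z x) (mulC z y).
move=> h1 h2 h3 h4 h5 h6 h7; apply: eq_coord => f; move: h1 h2 h3 h4 h5 h6 h7.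
move=> /(congr1 f) + /(congr1 f) + /(congr1 f) + /(congr1 f) +.
move=> + + + + /(congr1 f) + /(congr1 f) + /(congr1 f).
have fD := linearD f; rewrite !fD /=; lra.
Qed.

(** Exchanging [z] and [w] fixes the left side of [jordan_linearized], so the two right sides agree.
    As operators on [y]: L_(w(zx)) - L_(z(wx)) = [[L_w, L_z], L_x]. *)
Lemma mul_commutator x z w y :
  z ∘ (w ∘ (x ∘ y)) + x ∘ (w ∘ (z ∘ y)) + (w ∘ (z ∘ x)) ∘ y =
  w ∘ (z ∘ (x ∘ y)) + x ∘ (z ∘ (w ∘ y)) + (z ∘ (w ∘ x)) ∘ y.
Proof.
have := jordan_linearized x y z w; have := jordan_linearized x y w z.
rewrite (mulC w z) (mulC x z) (mulC x w) (mulC (y ∘ z) (w ∘ x)).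
rewrite (mulC (y ∘ w) (z ∘ x)).
rewrite (mulC z (w ∘ (x ∘ y))) (mulC w (x ∘ y)) (mulC x (w ∘ (z ∘ y))).
rewrite (mulC w (z ∘ y)) (mulC z y) (mulC w (z ∘ x)) (mulC w (z ∘ (x ∘ y))).
rewrite (mulC z (x ∘ y)) (mulC x (z ∘ (w ∘ y))) (mulC z (w ∘ y)) (mulC w y).
rewrite (mulC z (w ∘ x)).
move=> h1 h2; apply: eq_coord => f.
move: h1 h2 => /(congr1 f) + /(congr1 f); have fD := linearD f; rewrite !fD /=; lra.
Qed.

Definition mul_trace x : R := fun_trace (mul x).

Lemma mul_traceP a x y : mul_trace (a *: x + y) = a * mul_trace x + mul_trace y.
Proof.
rewrite -fun_traceP; apply: eq_fun_trace => z.
by rewrite mulDl mulZl.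
Qed.

Lemma mul_trace0 : mul_trace 0 = 0.
Proof. by have := mul_traceP (-1) 0 0; rewrite scaler0 addr0 mulN1r addNr. Qed.

Lemma mul_traceA x y z : mul_trace (x ∘ (y ∘ z)) = mul_trace (y ∘ (x ∘ z)).
Proof.
(* Cyclicity moves L_z to the right, so that the triple products on the two sides cancel in
   pairs. *)
have trE u v : fun_trace (mul z \o (mul u \o mul v)) =
               fun_trace (mul u \o (mul v \o mul z)).
  by rewrite (fun_traceC (mul z) (mul u \o mul v)); apply: eq_fun_trace.
have : fun_trace (fun w => 1 *: ((y ∘ (x ∘ z)) ∘ w) +
         (1 *: (x ∘ (y ∘ (z ∘ w))) + z ∘ (y ∘ (x ∘ w)))) =
       fun_trace (fun w => 1 *: ((x ∘ (y ∘ z)) ∘ w) +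
         (1 *: (y ∘ (x ∘ (z ∘ w))) + z ∘ (x ∘ (y ∘ w)))).
  apply: eq_fun_trace => w; rewrite !scale1r addrC mul_commutator addrC //.
rewrite !fun_traceP !mul1r.
have := trE x y; have := trE y x; rewrite /mul_trace /comp /= => -> ->.
by rewrite (addrC (fun_trace (fun w => x ∘ _))) => /addIr.
Qed.

Lemma mul_trace_simple x :
  jordan_simple mul -> (forall y, mul_trace (x ∘ y) = 0) -> x = 0.
Proof.
move=> [[x0 x0n0] simple] x_rad.
pose b := vbasis (fullv : {vspace A}).
(* Pairing with a basis presents the radical as a kernel, hence as a [{vspace A}] to which
   simplicity applies. *)
pose rad y := \row_(i < \dim (fullv : {vspace A})) mul_trace (y ∘ b`_i).
have rad_linear : linear rad.
  by move=> a u v; apply/rowP => i; rewrite !mxE mulDl mulZl mul_traceP.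
pose radL : {linear A -> 'rV_(\dim (fullv : {vspace A}))} :=
  HB.pack rad (GRing.isLinear.Build R A _ *:%R rad rad_linear).
have radP y : y \in lker (linfun radL) <-> forall z, mul_trace (y ∘ z) = 0.
  rewrite memv_ker lfunE /=; split=> [/eqP/rowP y0 z|y0]; last first.
    by apply/eqP/rowP => i; rewrite !mxE.
  rewrite (coord_vbasis (memvf z)) linear_sum.
  elim/big_rec: _ => [|i u _ IHu]; first exact: mul_trace0.
  by rewrite linearZ mul_traceP IHu; have := y0 i; rewrite !mxE => ->; rewrite mulr0 addr0.
case: (simple (lker (linfun radL))) => [y z /radP y_rad | I0 | IT].
- by apply/radP => w; rewrite mulC (mulC z) mul_traceA.
- by apply/eqP; rewrite -memv0 -I0; apply/radP.
have /radP/(_ one) : one \in lker (linfun radL) by rewrite IT memvf.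
rewrite mul1 /mul_trace (eq_fun_trace mul1) fun_trace_id.
move/eqP; rewrite pnatr_eq0 => /eqP dim0; case/eqP: x0n0; apply: v2r_inj.
by apply/rowP => i; have := ltn_ord i; rewrite [X in (_ < X)%N]dim0.
Qed.

(** * Peirce decomposition and U_s for a symmetry *)

Section Symmetry.
Variable s : A.
Hypothesis ss : s ∘ s = one.

(* L_s has eigenvalues 1, -1 and 0: the range of L_s consists of the fixed points
   of L_s^2 and is the even Peirce part, while its kernel is the odd part. *)
Let s_swap z w : s ∘ ((s ∘ z) ∘ w) = (s ∘ z) ∘ (s ∘ w).
Proof.
have := jordan_linearized s s z w.
rewrite ss !mul1 (mulC z s) (mulC _ s) (mulC w z) => h.
by apply: eq_coord => f; move: h => /(congr1 f); rewrite !linearD /=; lra.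
Qed.

Let s_cube z : s ∘ (s ∘ (s ∘ z)) = s ∘ z.
Proof. by rewrite (mulC s (s ∘ z)) s_swap ss mulC mul1. Qed.

(** With [s_odd_even] and [s_odd], this makes the Peirce decomposition a Z/2-grading. *)
Let s_even z w : s ∘ (s ∘ ((s ∘ z) ∘ (s ∘ w))) = (s ∘ z) ∘ (s ∘ w).
Proof. by rewrite -s_swap s_cube. Qed.

Let s_odd_even z w : s ∘ z = 0 -> s ∘ (z ∘ (s ∘ w)) = 0.
Proof. by move=> sz; rewrite (mulC z) s_swap sz linear0. Qed.

Let s_odd z w : s ∘ z = 0 -> s ∘ w = 0 -> s ∘ (s ∘ (z ∘ w)) = z ∘ w.
Proof.
move=> sz sw; have := jordan_linearized z w s s.
rewrite ss (mulC w s) sz sw !mul0l !addr0.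
by rewrite (mulC (z ∘ w) one) (mulC (z ∘ w) s) (mulC (s ∘ _) s) mul1.
Qed.

Lemma Uop_linear : linear (Uop mul s).
Proof.
move=> a u v; rewrite /Uop !mulDr !mulZr mulrnDl scalerMnr opprD addrACA.
by rewrite -scalerBr.
Qed.

(** By [s_cube], P = L_s^2 is idempotent, and U_s = 2P - 1 is a reflection. *)
Lemma UopK : involutive (Uop mul s).
Proof.
move=> x; rewrite /Uop; apply: eq_coord => f.
rewrite !(linearD, linearN, linearMn) /= !(linearD, linearN, linearMn) /= !s_cube.
rewrite !(linearD, linearN, linearMn) /=; lra.
Qed.

(** U_s is 1 on the even part and -1 on the odd part, so it respects products by the grading. *)
Lemma Uop_mul x y : Uop mul s (x ∘ y) = Uop mul s x ∘ Uop mul s y.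
Proof.
have splitP u : exists p q, [/\ u = p + q, s ∘ (s ∘ p) = p & s ∘ q = 0].
  exists (s ∘ (s ∘ u)), (u - s ∘ (s ∘ u)).
  by rewrite addrC subrK s_cube linearB /= s_cube subrr.
have UE p q : s ∘ (s ∘ p) = p -> s ∘ q = 0 -> Uop mul s (p + q) = p - q.
  move=> sp sq; rewrite /Uop !mulDr sp sq linear0 addr0.
  by rewrite mulr2n opprD addrA addrK.
have [p [q [-> sp sq]]] := splitP x; have [p' [q' [-> sp' sq']]] := splitP y.
have spp' : s ∘ (s ∘ (p ∘ p' + q ∘ q')) = p ∘ p' + q ∘ q'.
  by rewrite !mulDr (s_odd sq sq') -sp -sp' s_even.
have spq' : s ∘ (p ∘ q' + q ∘ p') = 0.
  by rewrite mulDr (mulC p) -sp -sp' !s_odd_even // addr0.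
have -> : (p + q) ∘ (p' + q') = (p ∘ p' + q ∘ q') + (p ∘ q' + q ∘ p').
  by rewrite mulDl !mulDr (addrC (q ∘ p')) addrACA.
rewrite !UE // !mulDl !mulDr !(mulNl, mulNr) opprK; apply: eq_coord => f.
by rewrite !(linearD, linearN) /=; lra.
Qed.

(** L_(U_s x) = U_s L_x U_s is conjugate to L_x. *)
Lemma mul_trace_Uop x : mul_trace (Uop mul s x) = mul_trace x.
Proof.
pose U : {linear A -> A} :=
  HB.pack (Uop mul s) (GRing.isLinear.Build R A A *:%R (Uop mul s) Uop_linear).
transitivity (fun_trace (U \o (mul x \o U))).
  by apply: eq_fun_trace => y /=; rewrite Uop_mul UopK.
by rewrite fun_traceC; apply: eq_fun_trace => y /=; rewrite UopK.
Qed.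

End Symmetry.

Lemma two_local_1_automorphism_automorphism (D : A -> A) :
  jordan_simple mul -> two_local_1_automorphism mul one D ->
  jordan_automorphism mul D.
Proof.
move=> simple hD; pose t x y := mul_trace (x ∘ y).
have tC x y : t x y = t y x by rewrite /t mulC.
have tP a x y z : t (a *: x + y) z = a * t x z + t y z.
  by rewrite /t mulDl mulZl mul_traceP.
have t_nondeg x : (forall y, t x y = 0) -> x = 0 by exact: mul_trace_simple.
have Dt x y : t (D x) (D y) = t x y.
  (* One [s] serves both arguments, so a single isometry U_s moves the pair. *)
  have [s [ss -> ->]] := hD x y.
  by rewrite /t -Uop_mul // mul_trace_Uop.
have D_lin := isometry_linear tC tP t_nondeg Dt.
have DD x y : D (x + y) = D x + D y by have := D_lin 1 x y; rewrite !scale1r.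
have D0 : D 0 = 0 by have := D_lin (-1) 0 0; rewrite scaler0 addr0 scaleN1r addNr.
have Dsqr x : D (x ∘ x) = D x ∘ D x.
  by have [s [ss -> ->]] := hD x (x ∘ x); rewrite Uop_mul.
split=> //.
- by move=> a x; have := D_lin a x 0; rewrite D0 !addr0.
- exact: (isometry_bijective tC tP t_nondeg Dt).
move=> x y; have := Dsqr (x + y); have := Dsqr x; have := Dsqr y.
rewrite !(DD, mulDl, mulDr) (mulC y x) (mulC (D y) (D x)).
move=> hy hx hxy; apply: eq_coord => f; move: hy hx hxy.
by move=> /(congr1 f) + /(congr1 f) + /(congr1 f); rewrite !linearD /=; lra.
Qed.

End Jordan.

Theorem theorem5p8 (R : realType) (A : vectType R) (mul : A -> A -> A) (one : A)
    (hJ : is_unital_jordan_algebra mul one)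
    (hreal : formally_real mul)
    (hsimple : jordan_simple mul)
    (hexc : jordan_exceptional mul)
    (D : A -> A) (hD : two_local_1_automorphism mul one D) :
  jordan_automorphism mul D.
Proof. exact: (two_local_1_automorphism_automorphism hJ hsimple hD). Qed.
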